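(* In Picaria, player X cannot win when moving from a Loop position; that is, from a Loop position with X to move, O has a strategy guaranteeing that X never obtains three X-stones on a line.
   Context: Picaria is played on the nine nodes of a $3\times 3$ grid; write $(r,c)$ for the node in row $r$ (rows $1,2,3$ from top to bottom) and column $c$ (columns $1,2,3$ from left to right). Two nodes are adjacent if they are distinct neighbours horizontally, vertically or diagonally. A line is one of the eight triples of nodes forming a row, a column or a main diagonal. Players X and O each own three stones and alternate turns; after all six stones are placed, in the sliding phase the mover slides one of its own stones to an adjacent empty node. A player wins as soon as its three stones occupy a line; infinite play is a draw. A Loop position is the sliding-phase position with O-stones on $(1,3),(2,1),(3,3)$, X-stones on $(2,2),(2,3),(3,1)$ (all other nodes empty) and X to move, or any image of it under a rotation or reflection of the board. *)

(* Defs.v *)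
From HB Require Import structures.
From mathcomp Require Import all_boot.

Set Implicit Arguments.
Unset Strict Implicit.
Unset Printing Implicit Defensive.

(* The row comes first; rows and columns are numbered from 0 in 'I_3. *)
Definition node : predArgType := ('I_3 * 'I_3)%type.

Definition coords (v : node) : nat * nat := (v.1.+1, v.2.+1).

Definition adjacent (u v : node) : bool :=
  [&& u != v, u.1 <= v.1.+1, v.1 <= u.1.+1, u.2 <= v.2.+1 & v.2 <= u.2.+1].

Definition lines : {set {set node}} :=
  [set [set v : node | v.1 == r] | r : 'I_3] :|:
  [set [set v : node | v.2 == c] | c : 'I_3] :|:
  [set [set v : node | v.1 == v.2]; [set v : node | v.1 == rev_ord v.2]].

Inductive player := PlayerX | PlayerO.

Definition player_is_O (s : player) : bool := if s is PlayerO then true else false.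
Definition player_of_bool (b : bool) : player := if b then PlayerO else PlayerX.
Lemma player_is_OK : cancel player_is_O player_of_bool. Proof. by case. Qed.
HB.instance Definition _ := Finite.copy player (can_type player_is_OK).

Definition opponent (s : player) : player :=
  if s is PlayerX then PlayerO else PlayerX.

Definition board : predArgType := {ffun node -> option player}.

Definition stones (s : player) (b : board) : {set node} :=
  [set v | b v == Some s].

Definition has_line (s : player) (b : board) : bool :=
  [exists L in lines, L \subset stones s b].

(* A sliding-phase position: the board together with the player to move. *)
Definition position : predArgType := (board * player)%type.

Definition slide_stone (b : board) (u v : node) : board :=
  [ffun w => if w == u then None else if w == v then b u else b w].

(* No move is legal once a player has won. *)
Definition legal_move (p q : position) : Prop :=
  [/\ ~~ has_line PlayerX p.1,
      ~~ has_line PlayerO p.1 &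
      exists u v : node,
        [/\ p.1 u = Some p.2, p.1 v = None, adjacent u v &
            q = (slide_stone p.1 u v, opponent p.2)]].

(* The answer may depend on the whole history: [h] lists the earlier positions
   in chronological order and [p] is the current one. *)
Definition strategy := seq position -> position -> position.

Definition legal_strategy (s : player) (sigma : strategy) : Prop :=
  forall h p, p.2 = s -> (exists q, legal_move p q) -> legal_move p (sigma h p).

(* [play_against s sigma p0 h p]: the positions of [h], followed by [p], form
   the beginning of a play from [p0] in which [s] moves according to [sigma]
   and the opponent makes arbitrary legal moves. *)
Inductive play_against (s : player) (sigma : strategy) (p0 : position) :
    seq position -> position -> Prop :=
| play_start : play_against s sigma p0 [::] p0
| play_own h p : play_against s sigma p0 h p -> p.2 = s ->
    legal_move p (sigma h p) ->
    play_against s sigma p0 (rcons h p) (sigma h p)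
| play_opponent h p q : play_against s sigma p0 h p -> p.2 = opponent s ->
    legal_move p q ->
    play_against s sigma p0 (rcons h p) q.

Definition rotate (v : node) : node := (v.2, rev_ord v.1).
Definition reflect_cols (v : node) : node := (v.1, rev_ord v.2).

(* The eight symmetries of the square. *)
Definition symmetry (k : nat) (m : bool) (v : node) : node :=
  iter k rotate (if m then reflect_cols v else v).

(* This is the image of [b] under the inverse of [f]; the symmetries are
   closed under inverses, so the family of images is the same. *)
Definition pull_board (f : node -> node) (b : board) : board :=
  [ffun v => b (f v)].

Definition loop_board : board :=
  [ffun v : node =>
     if coords v \in [:: (1, 3); (2, 1); (3, 3)] then Some PlayerO
     else if coords v \in [:: (2, 2); (2, 3); (3, 1)] then Some PlayerX
     else None].

Definition loop_position (p : position) : Prop :=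
  exists (k : nat) (m : bool),
    p = (pull_board (symmetry k m) loop_board, PlayerX).

(* Main.v *)
Require Import Defs.
From mathcomp Require Import all_boot.

(** O stays inside a set of positions with X to move that is closed under the
    symmetries of the board: up to symmetry there are nine of them, the Loop
    position being the first.  From each of them, no slide of X makes a line, and
    after each such slide O can either make a line or slide back into the set.
    This is a finite check, carried out by computation on lists of cells. *)

Set Implicit Arguments.
Unset Strict Implicit.
Unset Printing Implicit Defensive.

(** * Safety strategies: keeping an invariant forever *)

Lemma opponentK : involutive opponent.
Proof. by case. Qed.

Definition legal_moveb (p q : position) : bool :=
  [&& ~~ has_line PlayerX p.1, ~~ has_line PlayerO p.1 &
      [exists u : node, exists v : node,
        [&& p.1 u == Some p.2, p.1 v == None, adjacent u v &
            q == (slide_stone p.1 u v, opponent p.2)]]].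

Lemma legal_moveP (p q : position) : reflect (legal_move p q) (legal_moveb p q).
Proof.
apply: (iffP and3P) => -[HX HO Huv]; split=> //.
  have [u /existsP[v /and4P[/eqP Hu /eqP Hv Huv' /eqP Hq]]] := existsP Huv.
  by exists u, v.
case: Huv => u [v [Hu Hv Huv Hq]].
by apply/existsP; exists u; apply/existsP; exists v; rewrite Hu Hv Huv -Hq !eqxx.
Qed.

Lemma legal_move_turn (p q : position) : legal_move p q -> q.2 = opponent p.2.
Proof. by case=> _ _ [u [v [_ _ _ ->]]]. Qed.

(** A legal move into [good] comes first and any legal move second, so the strategy is legal even at
    positions where the invariant is already lost. The default [p] is reached only when no move is
    legal. *)
Definition keep_strategy (good : pred board) : strategy := fun _ p =>
  odflt (odflt p [pick q | legal_moveb p q])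
        [pick q | legal_moveb p q && good q.1].

Lemma keep_strategy_legal (good : pred board) (s : player) :
  legal_strategy s (keep_strategy good).
Proof.
move=> h p _ [q0 /legal_moveP Hq0]; rewrite /keep_strategy.
case: pickP => [q1 H1|/(_ q0)]; last by rewrite Hq0.
by case: pickP => [q /andP[Hq _]|_]; apply/legal_moveP.
Qed.

Lemma keep_strategy_good (good : pred board) h (p q : position) :
  legal_move p q -> good q.1 -> good (keep_strategy good h p).1.
Proof.
move=> /legal_moveP Hq Hg; rewrite /keep_strategy.
case: pickP => [q1 _|/(_ q)]; last by rewrite Hq.
by case: pickP => [q' /andP[]|/(_ q)] //=; rewrite Hq Hg.
Qed.

Lemma safety_strategy (s : player) (good : pred board) (b0 : board) :
  (forall b, good b -> ~~ has_line (opponent s) b) ->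
  (forall b q, good b -> legal_move (b, opponent s) q ->
     ~~ has_line (opponent s) q.1 /\
     exists2 q', legal_move q q' & good q'.1) ->
  good b0 ->
  exists sigma : strategy,
    legal_strategy s sigma /\
    (forall h q, play_against s sigma (b0, opponent s) h q ->
       ~~ has_line (opponent s) q.1).
Proof.
move=> good_line good_reply good_b0.
exists (keep_strategy good); split; first exact: keep_strategy_legal.
have neq_opp : opponent s <> s by case: (s).
move=> h q play; pose answerable (p : position) :=
  ~~ has_line (opponent s) p.1 /\ exists2 q', legal_move p q' & good q'.1.
(* The invariant depends on whose turn it is. Either half excludes a line of the opponent; at each
   step of the play one half is vacuous by [neq_opp]. *)
suff: (q.2 = s -> answerable q) /\ (q.2 = opponent s -> good q.1).
  case=> Hs Ho; case: (eqVneq q.2 s) => [/Hs[]//|].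
  by move=> q2; apply/good_line/Ho; case: (q.2) (s) q2 => -[].
elim: play => [|{}h p _ [Hs _] p2 mv|{}h p {}q _ [_ Ho] p2 mv]; first by [].
- have [_ [q' mv' good_q']] := Hs p2.
  split=> [|_]; last exact: keep_strategy_good mv' good_q'.
  by rewrite (legal_move_turn mv) p2.
- rewrite (legal_move_turn mv) p2 opponentK; split=> [_|/esym//].
  by apply: good_reply (Ho p2) _; rewrite -p2; case: (p) mv.
Qed.

(** * Lines as explicit lists of nodes *)

(** Literal ordinals, so that all lists built from them reduce under [vm_compute]. *)
Definition indices : seq 'I_3 :=
  [:: @Ordinal 3 0 isT; @Ordinal 3 1 isT; @Ordinal 3 2 isT].

Lemma mem_indices (i : 'I_3) : i \in indices.
Proof. by case: i => [[|[|[|]]]]. Qed.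

Definition nodes : seq node := [seq (r, c) | r <- indices, c <- indices].

Lemma mem_nodes (v : node) : v \in nodes.
Proof. by case: v => r c; apply: allpairs_f; apply: mem_indices. Qed.

Definition line_nodes : seq (seq node) :=
  [seq [seq (r, c) | c <- indices] | r <- indices] ++
  [seq [seq (r, c) | r <- indices] | c <- indices] ++
  [:: [seq (i, i) | i <- indices]; [seq (rev_ord i, i) | i <- indices]].

Lemma mem_lines (L : {set node}) :
  (L \in lines) = (L \in [seq [set:: l] | l <- line_nodes]).
Proof.
have row_set (r : 'I_3) :
    [set v : node | v.1 == r] = [set:: [seq (r, c) | c <- indices]].
  apply/setP=> -[r' c']; rewrite !in_set.
  apply/eqP/mapP => /= [-> | [c _ [-> _]] //].
  by exists c' => //; apply: mem_indices.
have col_set (c : 'I_3) :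
    [set v : node | v.2 == c] = [set:: [seq (r, c) | r <- indices]].
  apply/setP=> -[r' c']; rewrite !in_set.
  apply/eqP/mapP => /= [-> | [r _ [_ ->]] //].
  by exists r' => //; apply: mem_indices.
have diag_set :
    [set v : node | v.1 == v.2] = [set:: [seq (i, i) | i <- indices]].
  apply/setP=> -[r' c']; rewrite !in_set.
  apply/eqP/mapP => /= [-> | [i _ [-> ->]] //].
  by exists c' => //; apply: mem_indices.
have anti_set :
    [set v : node | v.1 == rev_ord v.2] =
    [set:: [seq (rev_ord i, i) | i <- indices]].
  apply/setP=> -[r' c']; rewrite !in_set.
  apply/eqP/mapP => /= [-> | [i _ [-> ->]] //].
  by exists c' => //; apply: mem_indices.
rewrite /lines /line_nodes !map_cat !mem_cat mem_seq2 !in_setU in_set1.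
rewrite in_set1 diag_set anti_set -!map_comp -orbA.
(* The two diagonals now agree on both sides; the families of rows and of columns remain. *)
congr [|| _, _ | _]; apply/imsetP/mapP => [] [i _ ->].
- by exists i; rewrite ?mem_indices ?row_set.
- by exists i; rewrite //= row_set.
- by exists i; rewrite ?mem_indices ?col_set.
- by exists i; rewrite //= col_set.
Qed.

Lemma has_lineE (s : player) (b : board) :
  has_line s b = has (all (fun v => b v == Some s)) line_nodes.
Proof.
have subE (l : seq node) :
    ([set:: l] \subset stones s b) = all (fun v => b v == Some s) l.
  apply/subsetP/allP => [sub v vl | sub v]; last by rewrite !inE => /sub.
  by have := sub v; rewrite !inE => ->.
apply/existsP/hasP => [[L /andP[]]|[l l_in Hl]].
  by rewrite mem_lines => /mapP[l l_in ->]; rewrite subE; exists l.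
by exists [set:: l]; rewrite mem_lines map_f // subE.
Qed.

(** * Boards as computable lists *)

(* The nine cells in row-major order. *)
Definition diagram := seq (option player).

(** Coordinates start at 0, so the index is the rank of [v] in [nodes]. *)
Definition cell (d : diagram) (v : node) : option player :=
  nth None d (3 * v.1 + v.2).

Definition diagram_of (f : node -> option player) : diagram :=
  [seq f v | v <- nodes].

Definition board_of (d : diagram) : board := [ffun v => cell d v].

Lemma cell_diagram_of (f : node -> option player) : cell (diagram_of f) =1 f.
Proof.
move=> v; have v_lt : 3 * v.1 + v.2 < size nodes.
  by case: v => [[[|[|[|?]]] ?] [[|[|[|?]]] ?]].
rewrite /cell (nth_map v) //; congr f; apply/eqP.
by case: v {v_lt} => [[[|[|[|?]]] ?] [[|[|[|?]]] ?]].
Qed.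

Lemma board_of_diagram_of (f : node -> option player) :
  board_of (diagram_of f) = [ffun v => f v].
Proof. by apply/ffunP=> v; rewrite !ffunE cell_diagram_of. Qed.

Definition diagram_line (s : player) (d : diagram) : bool :=
  has (all (fun v => cell d v == Some s)) line_nodes.

Lemma has_line_board_of (s : player) (d : diagram) :
  has_line s (board_of d) = diagram_line s d.
Proof.
by rewrite has_lineE; apply: eq_has => l; apply: eq_all => v; rewrite ffunE.
Qed.

Definition diagram_slide (d : diagram) (u v : node) : diagram :=
  diagram_of (fun w => if w == u then None else if w == v then cell d u
                       else cell d w).

Lemma slide_board_of (d : diagram) (u v : node) :
  slide_stone (board_of d) u v = board_of (diagram_slide d u v).
Proof. by rewrite board_of_diagram_of; apply/ffunP=> w; rewrite !ffunE. Qed.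

Definition diagram_moves (s : player) (d : diagram) : seq diagram :=
  [seq diagram_slide d m.1 m.2 |
     m <- [seq m <- [seq (u, v) | u <- nodes, v <- nodes] |
       [&& cell d m.1 == Some s, cell d m.2 == None & adjacent m.1 m.2]]].

(** Since [nodes] contains every node, the list [diagram_moves] misses no slide; quantifying over
    legal moves thus becomes scanning a list. *)
Lemma legal_move_board_of (s : player) (d : diagram) (q : position) :
  legal_move (board_of d, s) q <->
  [/\ ~~ diagram_line PlayerX d, ~~ diagram_line PlayerO d &
      exists2 e, e \in diagram_moves s d & q = (board_of e, opponent s)].
Proof.
rewrite /legal_move /= !has_line_board_of; split=> -[HX HO ex]; split=> //.
  case: ex => u [v]; rewrite !ffunE slide_board_of => -[Hu Hv Huv ->].
  exists (diagram_slide d u v) => //; apply/mapP; exists (u, v) => //.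
  rewrite mem_filter Hu Hv Huv !eqxx.
  by apply: allpairs_f; apply: mem_nodes.
case: ex => e /mapP[[u v]]; rewrite mem_filter /= => /andP[/and3P[]].
move=> /eqP Hu /eqP Hv Huv _ -> ->.
by exists u, v; rewrite !ffunE slide_board_of.
Qed.

(** * The safe set and the finite check *)

Local Notation X := (Some PlayerX).
Local Notation O := (Some PlayerO).
Local Notation e := (@None player).

Definition loop_diagram : diagram := [:: e; e; O;  O; X; X;  X; e; O].

(* Found by computer search, with as few diagrams as possible. *)
Definition core_diagrams : seq diagram :=
  [:: loop_diagram;
      [:: X; X; O;  O; O; X;  e; e; e];
      [:: X; O; e;  e; O; X;  O; X; e];
      [:: X; X; O;  O; X; O;  e; e; e];
      [:: X; e; e;  O; X; X;  O; e; O];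
      [:: X; O; e;  e; O; X;  e; X; O];
      [:: X; O; X;  O; O; e;  e; X; e];
      [:: X; O; X;  e; O; e;  O; X; e];
      [:: O; X; e;  X; X; O;  e; O; e]].

Definition pull_diagram (f : node -> node) (d : diagram) : diagram :=
  diagram_of (fun v => cell d (f v)).

Lemma pull_board_of (f : node -> node) (d : diagram) :
  pull_board f (board_of d) = board_of (pull_diagram f d).
Proof. by rewrite board_of_diagram_of; apply/ffunP=> v; rewrite !ffunE. Qed.

(** All eight images of each core diagram are listed, so the check covers them directly and no
    invariance of the rules under symmetry has to be proved. *)
Definition safe_diagrams : seq diagram :=
  [seq pull_diagram (symmetry km.1 km.2) d |
     km <- [seq (k, m) | k <- iota 0 4, m <- [:: false; true]],
     d <- core_diagrams].

(** The acceptable outcomes of a reply by O: the game is over in O's favour, or X is to move from a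
    safe diagram again. *)
Definition held (d : diagram) : bool :=
  ~~ diagram_line PlayerX d &&
  (diagram_line PlayerO d || (d \in safe_diagrams)).

(** After a slide of X, the absence of lines of either player makes the replies of O legal moves,
    and [has] provides one that is acceptable. *)
Lemma safe_diagrams_held :
  all (fun d => ~~ diagram_line PlayerX d &&
    all (fun t => [&& ~~ diagram_line PlayerX t, ~~ diagram_line PlayerO t &
                      has held (diagram_moves PlayerO t)])
      (diagram_moves PlayerX d)) safe_diagrams.
Proof. by vm_compute. Qed.

Lemma loop_boardE : loop_board = board_of loop_diagram.
Proof.
by apply/ffunP=> v; rewrite !ffunE; case: v => [[[|[|[|?]]] ?] [[|[|[|?]]] ?]].
Qed.

(** Four quarter turns reverse each coordinate twice. This brings the unbounded [k] of
    [loop_position] into the range used by [safe_diagrams]. *)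
Lemma symmetry_mod (k : nat) (m : bool) : symmetry k m =1 symmetry (k %% 4) m.
Proof.
have rotate4 v : iter 4 rotate v = v.
  by case: v => r c; rewrite /= /rotate /= !rev_ordK.
(* After [addnC] the full turns act first, and it remains to see that they fix the node. *)
move=> v; rewrite /symmetry {1}(divn_eq k 4) addnC iterD; congr iter.
by elim: (k %/ 4) => // n IHn; rewrite mulSn iterD IHn rotate4.
Qed.

Lemma loop_position_safe (p : position) : loop_position p ->
  exists2 d, d \in safe_diagrams & p = (board_of d, PlayerX).
Proof.
case=> k [m ->]; exists (pull_diagram (symmetry (k %% 4) m) loop_diagram).
  have km_in : (k %% 4, m) \in
      [seq (k, m) | k <- iota 0 4, m <- [:: false; true]].
    by apply: allpairs_f; [rewrite mem_iota ltn_pmod | case: m].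
  by apply/allpairsP; exists ((k %% 4, m), loop_diagram); rewrite mem_head.
rewrite loop_boardE -pull_board_of; congr (_, _).
by apply/ffunP=> v; rewrite !ffunE symmetry_mod.
Qed.

Theorem theorem2p5 : forall p : position, loop_position p ->
  exists sigma : strategy,
    legal_strategy PlayerO sigma /\
    (forall (h : seq position) (q : position),
       play_against PlayerO sigma p h q -> ~~ has_line PlayerX q.1).
Proof.
move=> p /loop_position_safe[d d_safe ->].
(* This is [held] carried over to boards. *)
pose good (b : board) := ~~ has_line PlayerX b &&
  (has_line PlayerO b || (b \in [seq board_of d | d <- safe_diagrams])).
have held_good t : held t -> good (board_of t).
  rewrite /good !has_line_board_of => /andP[-> /orP[-> //|t_safe]].
  by rewrite map_f ?orbT.
have /allP safe := safe_diagrams_held.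
apply: (@safety_strategy PlayerO good) => [b /andP[]//|b q|].
(* If O already has a line, X has no legal move; otherwise the board comes from a safe diagram and
   the finite check applies. *)
- case/andP=> _ /orP[Hline [_ /negP//]|/mapP[{}d {}d_safe ->]].
  case/legal_move_board_of=> _ _ [t t_move ->].
  have /andP[_ /allP/(_ t t_move)/and3P[tX tO]] := safe d d_safe.
  case/hasP=> t' t'_move /held_good t'_good; rewrite has_line_board_of; split=> //.
  exists (board_of t', PlayerX) => //; apply/legal_move_board_of; split=> //.
  by exists t'.
- have /andP[dX _] := safe d d_safe.
  by apply: held_good; rewrite /held dX d_safe orbT.
Qed.
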